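(* Let $E,A\in\mathbb{R}^{n\times n}$ with $\operatorname{rank}(E)=r$. Then the pair $(E,A)$ is admissible if and only if there exist invertible matrices $T,W\in\mathbb{R}^{n\times n}$ and matrices $S,U,B\in\mathbb{R}^{r\times r}$ with $S$ invertible, $U^TU=I_r$, $B$ symmetric positive semidefinite and $\|B\|\le 1$, such that $$E=W\begin{bmatrix} I_r&0\\0&0\end{bmatrix}T,\qquad A=W\begin{bmatrix} S^{-1}UBS&0\\0&I_{n-r}\end{bmatrix}T.$$
   Context: A pair $(E,A)$ of real $n\times n$ matrices is regular if $\det(\lambda E-A)$ is not identically zero as a polynomial in $\lambda$. For a regular pair, the finite eigenvalues are the roots of $\det(zE-A)$. A regular pair admits a Weierstrass canonical form $E=W\operatorname{diag}(I_q,N)T$, $A=W\operatorname{diag}(J,I_{n-q})T$ with $W,T$ nonsingular, $J$ in Jordan form and $N$ nilpotent in Jordan form; if $q<n$ the index of the pair is the nilpotency degree $\nu$ of $N$ (smallest $\nu\ge1$ with $N^\nu=0$), and the index is $0$ if $E$ is nonsingular. The pair is stable if all finite eigenvalues lie in the closed unit disk and those on the unit circle are semisimple. The pair is admissible if it is regular, of index at most one, and stable. $\|\cdot\|$ is the spectral norm. *)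

(* Defs.v *)
From HB Require Import structures.
From mathcomp Require Import all_boot all_order all_algebra.
Set Implicit Arguments. Unset Strict Implicit. Unset Printing Implicit Defensive.
Import Order.TTheory GRing.Theory Num.Theory.
Local Open Scope ring_scope.

(* Real matrices are modelled as matrices over a numeric algebraically closed
   field C (e.g. algC, or the complexification of any real closed field)
   whose entries are all real (M \is a realmx).  Eigenvalues live in C. *)
Notation realmx := (mxOver Num.real).

Section Pencil.
Variable C : numClosedFieldType.

Definition pencil_det (n : nat) (E A : 'M[C]_n) : {poly C} :=
  \det (\matrix_(i, j) ('X * (E i j)%:P - (A i j)%:P)).

Definition regular_pair (n : nat) (E A : 'M[C]_n) : Prop :=
  pencil_det E A != 0.

Definition finite_eig (n : nat) (E A : 'M[C]_n) (z : C) : Prop :=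
  root (pencil_det E A) z.

Definition alg_mult (n : nat) (E A : 'M[C]_n) (z : C) : nat :=
  mup z (pencil_det E A).
Definition geo_mult (n : nat) (E A : 'M[C]_n) (z : C) : nat :=
  (n - \rank (z *: E - A)%R)%N.

Definition semisimple_eig (n : nat) (E A : 'M[C]_n) (z : C) : Prop :=
  alg_mult E A z = geo_mult E A z.

Definition stable_pair (n : nat) (E A : 'M[C]_n) : Prop :=
  forall z : C, finite_eig E A z ->
    `|z| <= 1 /\ (`|z| = 1 -> semisimple_eig E A z).

Definition blkdiag (n q : nat) (h : (q <= n)%N) (X : 'M[C]_q) (Y : 'M[C]_(n - q)) :
  'M[C]_n := castmx (subnKC h, subnKC h) (block_mx X 0 0 Y).

(* index at most one: a Weierstrass canonical form exists with N = 0
   (nilpotency degree 1), or q = n (E nonsingular, index 0). *)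
Definition index_le1 (n : nat) (E A : 'M[C]_n) : Prop :=
  exists (q : nat) (h : (q <= n)%N) (W T : 'M[C]_n) (J : 'M[C]_q),
    [/\ W \in unitmx, T \in unitmx,
        E = W *m blkdiag h 1%:M 0 *m T &
        A = W *m blkdiag h J 1%:M *m T].

Definition admissible (n : nat) (E A : 'M[C]_n) : Prop :=
  [/\ regular_pair E A, index_le1 E A & stable_pair E A].

Definition psd (r : nat) (B : 'M[C]_r) : Prop :=
  forall x : 'cV[C]_r, x \is a realmx -> 0 <= (x^T *m B *m x) 0 0.

Definition spec_norm_le1 (r : nat) (B : 'M[C]_r) : Prop :=
  forall x : 'cV[C]_r, x \is a realmx ->
    ((B *m x)^T *m (B *m x)) 0 0 <= (x^T *m x) 0 0.

End Pencil.

(* Main.v *)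
(* An admissible pair has a real Weierstrass form with N = 0, since Gaussian
   elimination on a real matrix is real; the pencil determinant is then a
   constant times the characteristic polynomial of the finite block J.  So the
   theorem says that J has its spectrum in the closed disk, semisimple on the
   circle, iff S J S^-1 = U B for some real S, i.e. (polar decomposition) iff J
   is similar, by a real S, to a contraction.

   If J has that spectrum, splitting off the unimodular eigenspaces and
   shrinking the off-diagonal part of the remaining block triangular matrix
   makes J similar to a complex contraction: w -> |w Q|^2 decreases under J for
   some complex Q.  On real vectors, |w Q|^2 = |w Re Q|^2 + |w Im Q|^2 is a real
   quadratic form, whose Cholesky factor gives S.  Conversely, if x (M - z) = y
   and y M = z y with |z| = 1 and M a contraction, then taking x orthogonal to y
   gives |x|^2 + |y|^2 = |x M|^2 <= |x|^2, so y = 0. *)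
Require Import Defs.
From HB Require Import structures.
From mathcomp Require Import all_boot all_order all_algebra.
From mathcomp Require Import ring.
Import Order.TTheory GRing.Theory Num.Theory.
Local Open Scope ring_scope.
Set Implicit Arguments. Unset Strict Implicit. Unset Printing Implicit Defensive.

Local Notation "''[' u , v ]" := (dotmx u v) : ring_scope.
Local Notation "''[' u ]" := (dotmx u u) : ring_scope.

(** * Real matrices over [C] and the Hermitian norm of row vectors *)

Section RealMatrices.
Variable C : numClosedFieldType.

Lemma realmx_tr m n (A : 'M[C]_(m, n)) : A \is a realmx -> A^T \is a realmx.
Proof. by move=> /mxOverP RA; apply/mxOverP => i j; rewrite mxE. Qed.

Lemma realmx_row m n p (A : 'M[C]_(m, n)) (B : 'M[C]_(m, p)) :
  A \is a realmx -> B \is a realmx -> row_mx A B \is a realmx.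
Proof.
move=> /mxOverP RA /mxOverP RB; apply/mxOverP => i j.
by rewrite mxE; case: split.
Qed.

Lemma realmx_col m n p (A : 'M[C]_(m, n)) (B : 'M[C]_(p, n)) :
  A \is a realmx -> B \is a realmx -> col_mx A B \is a realmx.
Proof.
move=> /mxOverP RA /mxOverP RB; apply/mxOverP => i j.
by rewrite mxE; case: split.
Qed.

Lemma realmx_block m n p q (A : 'M[C]_(m, n)) B D (E : 'M[C]_(p, q)) :
  A \is a realmx -> B \is a realmx -> D \is a realmx -> E \is a realmx ->
  block_mx A B D E \is a realmx.
Proof. by move=> *; rewrite realmx_col ?realmx_row. Qed.

Lemma realmx0 m n : (0 : 'M[C]_(m, n)) \is a realmx.
Proof. by rewrite mxOver0 // real0. Qed.

Lemma realmx_scalar n (a : C) : a \is Num.real -> (a%:M : 'M_n) \is a realmx.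
Proof. by move=> Ra; rewrite mxOver_scalar // real0. Qed.

Lemma realmx1 n : (1%:M : 'M[C]_n) \is a realmx.
Proof. by rewrite realmx_scalar ?real1. Qed.

Lemma realmxM m n p (A : 'M[C]_(m, n)) (B : 'M[C]_(n, p)) :
  A \is a realmx -> B \is a realmx -> A *m B \is a realmx.
Proof. exact: mxOverM. Qed.

Lemma realmxN m n (A : 'M[C]_(m, n)) : A \is a realmx -> - A \is a realmx.
Proof. by move=> /mxOverP RA; apply/mxOverP => i j; rewrite mxE realN. Qed.

Lemma realmxB m n (A B : 'M[C]_(m, n)) :
  A \is a realmx -> B \is a realmx -> A - B \is a realmx.
Proof. by move=> RA RB; rewrite realmxD ?realmxN. Qed.

(** Inversion commutes with complex conjugation, so the inverse is fixed by it entrywise. *)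
Lemma realmx_inv n (A : 'M[C]_n) : A \is a realmx -> invmx A \is a realmx.
Proof.
move=> RA; apply/mxOverP => i j; apply/CrealP.
have /matrixP/(_ i j) := map_invmx (@Num.conj C) A.
by rewrite (realmxC RA) mxE.
Qed.

Lemma realmx_rect m n (A : 'M[C]_(m, n)) :
  exists A1 A2, [/\ A1 \is a realmx, A2 \is a realmx & A = A1 + 'i *: A2].
Proof.
exists (map_mx (@Re _) A), (map_mx (@Im _) A); split.
- by apply/mxOverP => i j; rewrite mxE Creal_Re.
- by apply/mxOverP => i j; rewrite mxE Creal_Im.
- by apply/matrixP => i j; rewrite !mxE -Crect.
Qed.

Lemma realmx_rect_eq0 m n (A B : 'M[C]_(m, n)) :
  A \is a realmx -> B \is a realmx -> A + 'i *: B = 0 -> A = 0 /\ B = 0.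
Proof.
move=> RA RB eq0; have := @eqmx_ReiIm _ _ _ A B 0 0 RA RB (realmx0 _ _) (realmx0 _ _).
by rewrite scaler0 addr0 => /(_ eq0) [].
Qed.

Lemma dot_ge0 n (u : 'rV[C]_n) : 0 <= '[u].
Proof. exact: dnorm_ge0. Qed.

Lemma dot_eq0 n (u : 'rV[C]_n) : ('[u] == 0) = (u == 0).
Proof. exact: dnorm_eq0. Qed.

Lemma dotZl n (a : C) (u v : 'rV[C]_n) : '[a *: u, v] = a * '[u, v].
Proof. by rewrite !dotmxE -scalemxAl mxE. Qed.

Lemma dotZ n (a : C) (u : 'rV[C]_n) : '[a *: u] = `|a| ^+ 2 * '[u].
Proof. exact: dnormZ. Qed.

Lemma dotD n (u v : 'rV[C]_n) :
  '[u + v] = '[u] + '[v] + ('[u, v] + ('[u, v])^*).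
Proof. exact: dnormD. Qed.

Lemma dotB n (u v : 'rV[C]_n) :
  '[u - v] = '[u] + '[v] - ('[u, v] + ('[u, v])^*).
Proof. exact: dnormB. Qed.

Lemma dot_realE n (u v : 'rV[C]_n) : v \is a realmx -> '[u, v] = (u *m v^T) 0 0.
Proof. by move=> Rv; rewrite dotmxE realmxC ?realmx_tr. Qed.

(** The cross term ['[a, 'i *: b]] is purely imaginary, because ['[a, b]] is real, and cancels
    against its conjugate. *)
Lemma dot_rect n (a b : 'rV[C]_n) : a \is a realmx -> b \is a realmx ->
  '[a + 'i *: b] = '[a] + '[b].
Proof.
move=> Ra Rb; rewrite dotD dotZ normCi expr1n mul1r.
rewrite linearZr_LR /= conjCi.
have /CrealP : '[a, b] \is Num.real.
  by rewrite dot_realE //; apply/mxOverP/realmxM/realmx_tr.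
by move=> Rab; rewrite rmorphM rmorphN /= conjCi Rab opprK mulNr addNr addr0.
Qed.

Lemma dot_row_mx m n (a : 'rV[C]_m) (b : 'rV[C]_n) :
  '[row_mx a b] = '[a] + '[b].
Proof. by rewrite !dotmxE tr_row_mx map_col_mx mul_row_col mxE. Qed.

(** Rows are acted on from the right, which matches left eigenvectors; a matrix and its transpose
    have the same spectral norm, so this says that the norm is at most one. *)
Definition contraction n (M : 'M[C]_n) := forall x : 'rV[C]_n, '[x *m M] <= '[x].

Lemma contraction_real n (M : 'M[C]_n) : M \is a realmx ->
  (forall x : 'rV[C]_n, x \is a realmx -> '[x *m M] <= '[x]) -> contraction M.
Proof.
move=> RM le x; have [a [b [Ra Rb ->]]] := realmx_rect x.
rewrite mulmxDl -scalemxAl !dot_rect ?realmxM //.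
by rewrite lerD ?le.
Qed.

End RealMatrices.

(** * Semisimple eigenvalues and their multiplicities over a field *)

Section Semisimple.
Variable F : fieldType.

(** Every Jordan block at [z] has size one; this is trivially true when [z] is not an eigenvalue. *)
Definition semisimple n (J : 'M[F]_n) (z : F) := forall x : 'rV[F]_n,
  x *m (J - z%:M) *m (J - z%:M) = 0 -> x *m (J - z%:M) = 0.

Lemma semisimple_similar n (P J K : 'M[F]_n) z : P \in unitmx ->
  P *m J = K *m P -> semisimple J z -> semisimple K z.
Proof.
move=> uP eqP ss x.
have eqPz : P *m (J - z%:M) = (K - z%:M) *m P.
  by rewrite mulmxBr mulmxBl eqP scalar_mxC.
have fP : row_free P by rewrite row_free_unit.
move=> x0; apply: (row_free_inj fP); rewrite mul0mx -mulmxA -eqPz mulmxA.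
by apply: ss; rewrite -!mulmxA (mulmxA P) eqPz -mulmxA eqPz !mulmxA x0 mul0mx.
Qed.

Lemma char_poly_similar n (P J K : 'M[F]_n) : P \in unitmx ->
  P *m J = K *m P -> char_poly J = char_poly K.
Proof.
move=> uP eqP; have mapPu : map_mx polyC P \in unitmx by rewrite map_unitmx.
have : map_mx polyC P *m char_poly_mx J = char_poly_mx K *m map_mx polyC P.
  by rewrite mulmxBr mulmxBl scalar_mxC -!map_mxM eqP.
move=> /(congr1 determinant); rewrite !det_mulmx mulrC => /mulIf; apply.
by move: mapPu; rewrite unitmxE; apply: contraTneq => ->; rewrite unitr0.
Qed.

Lemma unitmx_eigen n (M : 'M[F]_n) z :
  (M - z%:M \in unitmx) = ~~ root (char_poly M) z.
Proof.
by rewrite -eigenvalue_root_char negbK kermx_eq0 row_free_unit.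
Qed.

(* The first k rows of P span the eigenspace of J at z. *)
Lemma eigen_block n (J : 'M[F]_n) z :
  exists k m (e : (k + m)%N = n) (P : 'M[F]_n) (X : 'M[F]_(m, k)) (M : 'M[F]_m),
    [/\ k = (n - \rank (J - z%:M)%R)%N, P \in unitmx,
        P *m J = castmx (e, e) (block_mx z%:M 0 X M) *m P
      & row_free (row_mx X (M - z%:M))].
Proof.
set K := kermx (J - z%:M); set L := (K^C)%MS.
have e : (\rank K + \rank L)%N = n.
  by rewrite mxrank_compl subnKC ?rank_leq_col.
pose P0 := col_mx (row_base K) (row_base L).
have rP0 : row_free P0.
  rewrite /row_free -(addsmxE (row_base K)) mxrank_disjoint_sum ?eq_row_base //.
  apply/eqP; rewrite -submx0 (cap_eqmx (eq_row_base K) (eq_row_base L)).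
  by rewrite capmx_compl submx0.
have eR : row_base K *m J = z *: row_base K.
  apply/eqP; rewrite -mul_mx_scalar -subr_eq0 -mulmxBr.
  by apply/eqP/sub_kermxP; rewrite eq_row_base.
have /submxP[Z] : (row_base L *m J <= P0)%MS.
  by apply: submx_full; rewrite /row_full (eqP rP0) e.
rewrite -[Z]hsubmxK mul_row_col => eL.
have kE : \rank K = (n - \rank (J - z%:M)%R)%N by rewrite mxrank_ker.
move: (rsubmx Z) (lsubmx Z) eL rP0 eR kE; rewrite {}/P0.
move: (row_base K) (row_base L) e; move: (\rank K) (\rank L) => k m.
clear Z K L => K L e M X eL fP eR kE.
exists k, m, e; case: n / e J K L fP eL eR kE => J K L fP eL eR kE.
have uP : col_mx K L \in unitmx by rewrite -row_free_unit.
have eP : col_mx K L *m J = block_mx z%:M 0 X M *m col_mx K L.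
  by rewrite mul_col_mx eR eL mul_block_col mul_scalar_mx mul0mx addr0.
exists (col_mx K L), X, M; split; rewrite ?castmx_id //.
(* In the new basis [J - z%:M] has [k] zero rows on top of [row_mx X (M - z%:M)], whose rank is
   therefore [n - k = m], its number of rows. *)
have eZ : col_mx K L *m (J - z%:M) = col_mx 0 (row_mx X (M - z%:M)) *m col_mx K L.
  rewrite mulmxBr eP scalar_mxC -mulmxBl; congr (_ *m _).
  by rewrite (scalar_mx_block k m) /block_mx opp_col_mx add_col_mx !opp_row_mx
    !add_row_mx subrr !oppr0 !addr0 row_mx0.
have := congr1 mxrank eZ; rewrite (eqmxMfull _ _) ?row_full_unit // mxrankMfree
  ?row_free_unit // -addsmxE adds0mx => rE.
rewrite /row_free -rE eqn_leq; apply/andP; split.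
  by rewrite rE rank_leq_row.
by rewrite -(leq_add2l k) {2}kE subnK ?rank_leq_col.
Qed.

(** If [b] is killed by [M - z%:M], then [row_mx 0 b] is sent by the block matrix minus [z] to
    [row_mx (b *m X) 0], which lies in the eigenspace. Row freeness makes this image nonzero when
    [b] is. *)
Lemma semisimple_block k m z (X : 'M[F]_(m, k)) (M : 'M[F]_m) :
  row_free (row_mx X (M - z%:M)) ->
  semisimple (block_mx z%:M 0 X M) z <-> ~~ root (char_poly M) z.
Proof.
set N := M - z%:M => fXN; rewrite -unitmx_eigen -/N.
have eB : block_mx z%:M 0 X M - z%:M = block_mx 0 0 X N.
  by rewrite (scalar_mx_block k m) opp_block_mx add_block_mx subrr !oppr0 !addr0.
have mulB (a : 'rV_k) (b : 'rV_m) :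
    row_mx a b *m block_mx 0 0 X N = row_mx (b *m X) (b *m N).
  by rewrite mul_row_block !mulmx0 !add0r.
split=> [ss | uN x]; last first.
  rewrite eB -[x]hsubmxK !mulB -row_mx0 => /eq_row_mx[_].
  move=> /(canRL (mulmxK uN)); rewrite mul0mx => /(canRL (mulmxK uN)).
  by rewrite mul0mx => ->; rewrite !mul0mx.
rewrite -row_free_unit -kermx_eq0; apply/rowV0P => b /sub_kermxP bN0.
have := ss (row_mx 0 b); rewrite eB !mulB bN0 !mul0mx row_mx0.
move=> /(_ erefl); rewrite -row_mx0 => /eq_row_mx[bX0 _].
apply: (row_free_inj fXN).
by rewrite mul0mx mul_mx_row bX0 bN0 row_mx0.
Qed.

Lemma char_poly_block k m z (X : 'M[F]_(m, k)) (M : 'M[F]_m) :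
  char_poly (block_mx z%:M 0 X M) = ('X - z%:P) ^+ k * char_poly M.
Proof.
rewrite /char_poly /char_poly_mx map_block_mx (scalar_mx_block k m).
rewrite opp_block_mx add_block_mx map_mx0 oppr0 addr0 det_lblock.
by rewrite map_scalar_mx -raddfB det_scalar.
Qed.

(** After [eigen_block], the geometric multiplicity is [k] and the characteristic polynomial is
    [('X - z%:P) ^+ k] times [char_poly M], so both sides say that [z] is no root of
    [char_poly M]. *)
Lemma semisimple_mup n (J : 'M[F]_n) z :
  mup z (char_poly J) = (n - \rank (J - z%:M)%R)%N <-> semisimple J z.
Proof.
have [k [m [e [P [X [M [kE uP eP fXM]]]]]]] := eigen_block J z; rewrite -kE.
case: n / e J P kE uP eP => J P kE uP; rewrite castmx_id => eP.
have -> : semisimple J z <-> semisimple (block_mx z%:M 0 X M) z.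
  split; first exact: semisimple_similar eP.
  apply: (@semisimple_similar _ (invmx P)); rewrite ?unitmx_inv //.
  by rewrite -[LHS](mulmxK uP) -(mulmxA (invmx P)) -eP mulKmx.
rewrite (char_poly_similar uP eP) char_poly_block mupM; last 2 first.
- by rewrite expf_neq0 ?polyXsubC_eq0.
- by rewrite monic_neq0 ?char_poly_monic.
rewrite mup_XsubCX eqxx; split=> [/eqP|ss].
  rewrite -{2}[k]addn0 eqn_add2l => mup0; apply: (semisimple_block fXM).2.
  by rewrite -dvdp_XsubCl XsubC_dvd ?monic_neq0 ?char_poly_monic // (eqP mup0).
by rewrite mupNroot ?addn0 //; apply: (semisimple_block fXM).1.
Qed.

End Semisimple.

(** * Similarity over [C] to a contraction *)

Section Contractions.
Variable C : numClosedFieldType.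

(** Young's inequality: expand ['[d *: u - v] >= 0] and divide by [d]. *)
Lemma dot_young n (d : C) (u v : 'rV[C]_n) : 0 < d ->
  '[u + v] <= (1 + d) * '[u] + (1 + d^-1) * '[v].
Proof.
move=> d_gt0; pose s := '[u, v] + ('[u, v])^*.
have := dot_ge0 (d *: u - v).
rewrite dotB dotZ (ger0_norm (ltW d_gt0)) dotZl rmorphM /=.
rewrite (CrealP (gtr0_real d_gt0)) -mulrDr dotD -/s => le.
rewrite -subr_ge0.
have -> : (1 + d) * '[u] + (1 + d^-1) * '[v] - ('[u] + '[v] + s) =
    d^-1 * (d ^+ 2 * '[u] + '[v] - d * s) by field; rewrite gt_eqF.
by apply: mulr_ge0 le; rewrite invr_ge0 ltW.
Qed.

(** Cauchy-Schwarz column by column; [K] is the squared Frobenius norm of [Y]. *)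
Lemma dot_mulmx_bound m n (Y : 'M[C]_(m, n)) :
  exists2 K : C, 0 <= K & forall b : 'rV[C]_m, '[b *m Y] <= K * '[b].
Proof.
exists (\sum_j '[map_mx Num.conj (col j Y)^T]).
  by rewrite sumr_ge0 // => j _; apply: dot_ge0.
move=> b; rewrite {1}dotmxE mxE mulr_suml ler_sum // => j _.
rewrite [leLHS](_ : _ = `|'[b, map_mx Num.conj (col j Y)^T]| ^+ 2).
  by rewrite mulrC; apply: CauchySchwarz.
rewrite normCK !mxE dotmxE !mxE.
have -> : \sum_i b 0 i * Y i j =
    \sum_i b 0 i * (map_mx Num.conj (map_mx Num.conj (col j Y)^T)^T) i 0.
  by apply: eq_bigr => i _; rewrite !mxE conjCK.
by [].
Qed.

(** Induction on the size: an eigenspace is split off, and scaling the other basis rows by a small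
    [t] shrinks the coupling block. The uniform factor [c < 1] provides the slack that absorbs what
    is left of it. *)
Lemma strict_contraction n (J : 'M[C]_n) :
  (forall z, root (char_poly J) z -> `|z| < 1) ->
  exists (P M : 'M[C]_n) (c : C), [/\ P \in unitmx, P *m J = M *m P, 0 <= c, c < 1
    & forall x : 'rV[C]_n, '[x *m M] <= c * '[x]].
Proof.
have [N] := ubnP n; elim: N n J => [//|N IHN] n J /ltnSE le_nN J_lt1.
have [n0|n_gt0] := posnP n.
  move: J J_lt1; rewrite {}n0 => J _; exists 1%:M, J, 0; split=> //.
  - exact: unitmx1.
  - by rewrite mulmx1 mul1mx.
  - by move=> x; rewrite mul0r (thinmx0 (x *m J)) -(scale0r (0 : 'rV_0)) dotZ normr0 expr0n mul0r.
have [z] := eigenvalue_closed J n_gt0; rewrite eigenvalue_root_char => Jz.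
have [k [m [e [P [X [M [kE uP eP fXM]]]]]]] := eigen_block J z.
have m_lt : (m < n)%N.
  rewrite -e -[m in leqLHS]add0n ltn_add2r kE subn_gt0 ltn_neqAle rank_leq_col andbT.
  by have := unitmx_eigen J z; rewrite Jz -row_free_unit => /negbT.
case: n / e J J_lt1 n_gt0 Jz P m_lt uP eP le_nN {kE} => J J_lt1 _ Jz P m_lt uP.
rewrite castmx_id => eP le_N.
have cJ := char_poly_similar uP eP; rewrite char_poly_block in cJ.
have M_lt1 w : root (char_poly M) w -> `|w| < 1.
  by move=> Mw; apply: J_lt1; rewrite cJ rootM Mw orbT.
have [Q [M' [c [uQ eQ c_ge0 c_lt1 leM]]]] := IHN m M (leq_trans m_lt le_N) M_lt1.
have s_lt1 : `|z| ^+ 2 < 1 by rewrite expr_lt1 // J_lt1.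
have [K K_ge0 leK] := dot_mulmx_bound (Q *m X).
set s := `|z| ^+ 2 in s_lt1; have s_ge0 : 0 <= s by rewrite exprn_ge0.
(* Half of the gap [1 - s] pays for the factor [1 + d] that Young's inequality puts on the diagonal
   part. *)
pose d : C := (1 - s) / 2.
have d_gt0 : 0 < d by rewrite divr_gt0 // subr_gt0.
have d_le : d <= 2^-1 by rewrite ler_piMl ?invr_ge0 // lerBlDr lerDl.
(* Chosen so that the coupling costs at most [(1 - c) / 2] times ['[b]]; [t] is its square root
   because norms are squared. *)
pose e : C := (1 - c) / 2 / ((1 + d^-1) * (K + 1)).
have dV_gt0 : 0 < 1 + d^-1 by rewrite addr_gt0 ?invr_gt0.
have K1_gt0 : 0 < K + 1 by rewrite ltr_wpDl.
have e_gt0 : 0 < e by rewrite !divr_gt0 ?mulr_gt0 // subr_gt0.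
pose t := sqrtC e; have t_gt0 : 0 < t by rewrite sqrtC_gt0.
exists (block_mx 1%:M 0 0 (t *: Q) *m P), (block_mx z%:M 0 (t *: (Q *m X)) M').
(* This dominates both the rate [(1 + d) * s] on the eigenspace and [(1 + c) / 2] on the rest, the
   latter since [d <= 2^-1]. *)
exists (1 - d * (1 - c)); split.
- rewrite unitmx_mul uP andbT unitmxE det_lblock det1 mul1r -unitmxE.
  by rewrite unitmxZ // unitfE gt_eqF.
- rewrite -mulmxA eP !mulmxA; congr (_ *m _).
  rewrite !mulmx_block !mulmx1 !mulmx0 !mul0mx !mul1mx !addr0 !add0r.
  by rewrite -!scalemxAl -scalemxAr eQ.
- rewrite subr_ge0; apply: mulr_ile1; rewrite ?subr_ge0 ?(ltW d_gt0) ?(ltW c_lt1) //.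
    by apply: le_trans d_le _; rewrite invf_le1 ?ler1n.
  by rewrite lerBlDr lerDl.
- by rewrite gtrDl oppr_lt0 mulr_gt0 // subr_gt0.
move=> x; rewrite -[x]hsubmxK; move: (lsubmx x) (rsubmx x) => a b.
rewrite mul_row_block mulmx0 add0r !dot_row_mx mul_mx_scalar mulrDr.
have -> : b *m (t *: (Q *m X)) = t *: (b *m (Q *m X)) by rewrite -scalemxAr.
apply: le_trans (lerD (dot_young _ _ d_gt0) (leM b)) _.
rewrite -addrA !dotZ /= -/s lerD //.
  rewrite mulrA ler_wpM2r ?dot_ge0 //.
  rewrite -subr_ge0.
  have -> : 1 - d * (1 - c) - (1 + d) * s = d * (c + (1 - s)).
    by rewrite /d; field.
  by apply: mulr_ge0; [exact: ltW | rewrite addr_ge0 ?subr_ge0 ?(ltW s_lt1)].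
have -> : `|t| ^+ 2 = e by rewrite ger0_norm ?ltW // sqrtCK.
have leb : '[b *m (Q *m X)] <= (K + 1) * '[b].
  by apply: le_trans (leK b) _; rewrite ler_wpM2r ?dot_ge0 // lerDl.
apply: le_trans (_ : (1 + d^-1) * (e * ((K + 1) * '[b])) + c * '[b] <= _).
  by rewrite lerD2r ler_wpM2l ?(ltW dV_gt0) // ler_wpM2l // ltW.
have -> : (1 + d^-1) * (e * ((K + 1) * '[b])) = (1 - c) / 2 * '[b].
  by rewrite /e; field; rewrite (gt_eqF d_gt0) (gt_eqF K1_gt0) gt_eqF ?addr_gt0.
rewrite -mulrDl ler_wpM2r ?dot_ge0 // -subr_ge0.
have -> : 1 - d * (1 - c) - ((1 - c) / 2 + c) = (1 - c) * (2^-1 - d) by field.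
by rewrite mulr_ge0 ?subr_ge0 // ltW.
Qed.


(** Stability of a pair, read on the finite block of its Weierstrass form. *)
Definition disk_semisimple n (J : 'M[C]_n) := forall z,
  root (char_poly J) z -> `|z| <= 1 /\ (`|z| = 1 -> semisimple J z).

(** Unimodular eigenvalues are peeled off one at a time: semisimplicity lets the eigenspace be
    decoupled completely, and [z] acts on it isometrically. Once none is left, [strict_contraction]
    applies. *)
Lemma disk_contraction n (J : 'M[C]_n) : disk_semisimple J ->
  exists P M : 'M[C]_n, [/\ P \in unitmx, P *m J = M *m P & contraction M].
Proof.
have [N] := ubnP n; elim: N n J => [//|N IHN] n J /ltnSE le_nN dJ.
(* Listing the roots makes the existence of a unimodular one decidable. *)
have [r cJr] := closed_field_poly_normal (char_poly J).
have rootJ z : root (char_poly J) z = (z \in r).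
  rewrite cJr rootZ ?root_prod_XsubC //.
  by rewrite lead_coef_eq0 monic_neq0 ?char_poly_monic.
have [/hasP[z zr /eqP z1]|/hasPn no1] := boolP (has (fun z => `|z| == 1) r); last first.
  have [|P [M [c [uP eP c_ge0 c_lt1 leM]]]] := @strict_contraction n J.
    move=> z Jz; rewrite lt_neqAle no1 -?rootJ //.
    by have [] := dJ z Jz.
  exists P, M; split=> // x; apply: le_trans (leM x) _.
  by rewrite ler_piMl ?dot_ge0 ?ltW.
have Jz : root (char_poly J) z by rewrite rootJ.
have ssJz := (dJ z Jz).2 z1.
have [k [m [e [P [X [M [kE uP eP fXM]]]]]]] := eigen_block J z.
have m_lt : (m < n)%N.
  rewrite -e -[m in leqLHS]add0n ltn_add2r kE subn_gt0 ltn_neqAle rank_leq_col andbT.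
  by have := unitmx_eigen J z; rewrite Jz -row_free_unit => /negbT.
case: n / e J dJ cJr rootJ Jz ssJz P m_lt uP eP le_nN {kE}
  => J dJ _ _ Jz ssJz P m_lt uP; rewrite castmx_id => eP le_N.
have cJ := char_poly_similar uP eP; rewrite char_poly_block in cJ.
have uN : M - z%:M \in unitmx.
  rewrite unitmx_eigen; apply: (semisimple_block fXM).1.
  exact: semisimple_similar uP eP ssJz.
(* Solves the Sylvester equation [M *m Y - z *: Y = X], so that the change of basis
   [block_mx 1%:M 0 Y 1%:M] removes the block [X]. *)
pose Y := invmx (M - z%:M) *m X.
have eY : M *m Y = z *: Y + X.
  by rewrite -[M in LHS](subrK z%:M) mulmxDl mulKVmx // mul_scalar_mx addrC.
pose R := block_mx 1%:M 0 Y 1%:M *m P; pose D := block_mx (z%:M : 'M_k) 0 0 M.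
have uR : R \in unitmx by rewrite unitmx_mul uP andbT unitmxE det_lblock !det1 mulr1 unitr1.
have eR : R *m J = D *m R.
  rewrite -mulmxA eP !mulmxA; congr (_ *m _).
  rewrite !mulmx_block !mulmx1 !mulmx0 !mul0mx !mul1mx !addr0 !add0r.
  by rewrite eY mul_mx_scalar.
have dM : disk_semisimple M.
  move=> w Mw; have [|w_le1 ssw] := dJ w; first by rewrite cJ rootM Mw orbT.
  split=> // w1 b; have /(_ (row_mx 0 b)) : semisimple D w.
    exact: semisimple_similar uR eR (ssw w1).
  rewrite (scalar_mx_block k m) opp_block_mx add_block_mx !oppr0 !addr0.
  rewrite !mul_row_block !mul0mx !mulmx0 !add0r => ssb b0.
  move: ssb; rewrite b0 mul0mx addr0 row_mx0 => /(_ erefl).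
  by rewrite -row_mx0 => /eq_row_mx[].
have [Q [M' [uQ eQ cM]]] := IHN m M (leq_trans m_lt le_N) dM.
exists (block_mx 1%:M 0 0 Q *m R), (block_mx z%:M 0 0 M'); split.
- by rewrite unitmx_mul uR andbT unitmxE det_lblock det1 mul1r.
- rewrite -mulmxA eR !mulmxA; congr (_ *m _).
  by rewrite !mulmx_block !mulmx1 !mulmx0 !mul0mx !mul1mx !addr0 !add0r eQ.
move=> x; rewrite -[x]hsubmxK; move: (lsubmx x) (rsubmx x) => a b.
rewrite mul_row_block !mulmx0 add0r addr0 !dot_row_mx mul_mx_scalar.
by rewrite dotZ z1 expr1n mul1r lerD2l.
Qed.

End Contractions.

(** * Real contractions, Cholesky factors and polar decomposition *)

Section RealFactorizations.
Variable C : numClosedFieldType.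

Lemma disk_semisimple_similar n (P J K : 'M[C]_n) : P \in unitmx ->
  P *m J = K *m P -> disk_semisimple J -> disk_semisimple K.
Proof.
move=> uP eqP dJ z; rewrite -(char_poly_similar uP eqP) => /dJ[z_le1 ssz].
by split=> // /ssz; apply: semisimple_similar uP eqP.
Qed.

Lemma contraction_disk n (M : 'M[C]_n) : contraction M -> disk_semisimple M.
Proof.
move=> cM z; rewrite -eigenvalue_root_char => /eigenvalueP[v vM v_neq0]; split.
  have := cM v; rewrite vM dotZ -{2}['[v]]mul1r ler_pM2r; last first.
    by rewrite lt_def dot_eq0 v_neq0 dot_ge0.
  by rewrite expr_le1.
move=> z1 x; set y := x *m _ => yM0.
have yM : y *m M = z *: y.
  by apply/eqP; rewrite -subr_eq0 -mul_mx_scalar -mulmxBr yM0.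
have xM : x *m M = z *: x + y by rewrite /y mulmxBr mul_mx_scalar addrC subrK.
apply/eqP/negPn/negP => y_neq0; have y2_neq0 : '[y] != 0 by rewrite dot_eq0.
(* Replace x by its component orthogonal to y, so that Pythagoras applies. *)
pose c := '[x, y] / '[y]; pose u := x - c *: y.
have uy : '[u, y] = 0.
  rewrite dotmxE mulmxBl mxE -!dotmxE -scalemxAl [X in _ + X]mxE [X in - X]mxE.
  by rewrite -dotmxE divfK ?subrr.
have uM : u *m M = z *: u + y.
  rewrite mulmxBl -scalemxAl yM xM scalerBr !scalerA mulrC.
  by rewrite -!addrA (addrC y).
have := cM u; rewrite uM dotD dotZ z1 dotZl uy mulr0 conjC0 !addr0 expr1n mul1r.
by rewrite gerDl => le0; case/eqP: y2_neq0; apply/eqP; rewrite eq_le le0 dot_ge0.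
Qed.

(** Induction through the Schur complement of the corner entry [g]; the first column of [L] is that
    of [G] divided by the square root of [g]. *)
Lemma cholesky n (G : 'M[C]_n) : G \is a realmx -> G^T = G ->
  (forall w : 'rV[C]_n, w \is a realmx -> w != 0 -> 0 < (w *m G *m w^T) 0 0) ->
  exists L : 'M[C]_n, [/\ L \is a realmx, L \in unitmx & G = L *m L^T].
Proof.
elim: n G => [|n IHn] G RG symG pdG.
  by exists 1%:M; rewrite unitmx1 realmx1; split=> //; rewrite [LHS]flatmx0 [RHS]flatmx0.
move: G RG symG pdG; rewrite -[n.+1]/(1 + n)%N => G RG.
pose g := G 0 0; pose x := dlsubmx G; pose G' := drsubmx G.
have Rx : x \is a realmx by apply/mxOverP => i j; rewrite !mxE (mxOverP RG).
have RG' : G' \is a realmx by apply/mxOverP => i j; rewrite !mxE (mxOverP RG).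
have eul : ulsubmx G = g%:M.
  by rewrite [LHS]mx11_scalar !mxE; congr (G _ _)%:M; apply: val_inj.
rewrite -[G]submxK eul -/x -/G' tr_block_mx => /eq_block_mx[_ <- _ symG'] pdG.
have g_gt0 : 0 < g.
  have := pdG (row_mx 1%:M 0); rewrite realmx_row ?realmx0 ?realmx1 //.
  rewrite tr_row_mx mul_row_block mul_row_col trmx1 trmx0 !mulmx0 !mul0mx mul1mx mulmx1.
  rewrite !addr0 mxE eqxx mulr1n; apply=> //.
  by rewrite -row_mx0; apply/eqP => /eq_row_mx[/matrixP/(_ 0 0)/eqP]; rewrite !mxE oner_eq0.
have Rg := gtr0_real g_gt0.
have [||| L [RL uL eL]] := IHn (G' - g^-1 *: (x *m x^T)).
- by rewrite realmxB // mxOverZ ?realV // realmxM // realmx_tr.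
- by rewrite raddfB /= symG' linearZ /= trmx_mul trmxK.
(* This [a] cancels the cross term, so the form of [G] at [row_mx a b] equals that of the Schur
   complement at [b]. *)
- move=> b Rb b_neq0; pose a := - (g^-1 *: (b *m x)).
  have Ra : a \is a realmx by rewrite realmxN // mxOverZ ?realV // realmxM.
  have := pdG (row_mx a b); rewrite realmx_row //.
  rewrite tr_row_mx mul_row_block mul_row_col => /(_ isT).
  rewrite mul_mx_scalar scalerN scalerA divff ?gt_eqF // scale1r addNr mul0mx add0r.
  have -> : a *m x^T + b *m G' = b *m (G' - g^-1 *: (x *m x^T)).
    by rewrite mulmxBr -scalemxAr mulNmx -scalemxAl mulmxA addrC.
  apply; apply: contraNneq b_neq0; rewrite -row_mx0 => /eq_row_mx[_ ->].
  by [].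
pose s := sqrtC g; have s_gt0 : 0 < s by rewrite sqrtC_gt0.
have Rs := gtr0_real s_gt0.
exists (block_mx s%:M 0 (s^-1 *: x) L); split.
- by rewrite realmx_block ?realmx0 ?realmx_scalar ?mxOverZ ?realV.
- by rewrite unitmxE det_lblock det_scalar expr1 unitrM -unitmxE uL unitfE gt_eqF.
rewrite tr_block_mx mulmx_block !trmx0 !mulmx0 !mul0mx !addr0 tr_scalar_mx.
rewrite -scalar_mxM -expr2 sqrtCK linearZ /= mul_scalar_mx scalerA divff ?gt_eqF //.
rewrite mul_mx_scalar scalerA divff ?gt_eqF // !scale1r -eL.
rewrite -scalemxAl -scalemxAr scalerA -invfM -expr2 sqrtCK.
by rewrite addrC subrK.
Qed.

Lemma disk_real_contraction n (J : 'M[C]_n) : J \is a realmx -> disk_semisimple J ->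
  exists S : 'M[C]_n,
    [/\ S \is a realmx, S \in unitmx & contraction (S *m J *m invmx S)].
Proof.
move=> RJ /disk_contraction[P [M [uP eP cM]]].
have uQ : invmx P \in unitmx by rewrite unitmx_inv.
have eQ : J *m invmx P = invmx P *m M.
  by rewrite -[RHS](mulmxK uP) -(mulmxA (invmx P)) -eP mulKmx.
move: (invmx P) uQ eQ => Q uQ eQ; have [Q1 [Q2 [R1 R2 defQ]]] := realmx_rect Q.
(* The real part of [Q] times its conjugate transpose. *)
pose G := Q1 *m Q1^T + Q2 *m Q2^T.
have eG (w : 'rV[C]_n) : w \is a realmx -> '[w *m Q] = (w *m G *m w^T) 0 0.
  move=> Rw; rewrite defQ mulmxDr -scalemxAr dot_rect ?realmxM //.
  rewrite !dot_realE ?realmxM // !trmx_mul mulmxDr mulmxDl [RHS]mxE.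
  by rewrite !mulmxA.
have [||w Rw w_neq0|L [RL uL eL]] := @cholesky n G.
- by rewrite realmxD // realmxM ?realmx_tr.
- by rewrite raddfD /= !trmx_mul !trmxK.
- rewrite -eG // lt_def dot_eq0 dot_ge0 andbT.
  by apply: contraNneq w_neq0 => /(canRL (mulmxK uQ)); rewrite mul0mx => ->.
have eLQ (w : 'rV[C]_n) : w \is a realmx -> '[w *m L] = '[w *m Q].
  move=> Rw; rewrite eG // dot_realE ?realmxM // trmx_mul eL.
  by rewrite !mulmxA.
(* On real rows multiplication by [L] and by [Q] give the same norm, and [J *m Q = Q *m M] shows
   that [J] does not increase it. *)
exists (invmx L); split; rewrite ?unitmx_inv ?realmx_inv // invmxK.
apply: contraction_real => [|x Rx]; first by rewrite !realmxM ?realmx_inv.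
rewrite !mulmxA; have Rw : x *m invmx L \is a realmx by rewrite realmxM ?realmx_inv.
rewrite eLQ; last by rewrite realmxM.
rewrite -(mulmxA _ J) eQ mulmxA; apply: le_trans (cM _) _.
by rewrite -eLQ // mulmxKV.
Qed.

(** The real and imaginary parts of [x] are both killed by the real matrix [G]; a nonzero one is
    normalized. *)
Lemma real_kernel n (G : 'M[C]_n) (x : 'rV[C]_n) : G \is a realmx ->
  x != 0 -> x *m G = 0 ->
  exists v : 'rV[C]_n, [/\ v \is a realmx, '[v] = 1 & v *m G = 0].
Proof.
move=> RG x_neq0; have [a [b [Ra Rb xE]]] := realmx_rect x.
rewrite xE mulmxDl -scalemxAl => /realmx_rect_eq0[||aG bG]; rewrite ?realmxM //.
have [w [Rw w_neq0 wG]] : exists w : 'rV[C]_n, [/\ w \is a realmx, w != 0 & w *m G = 0].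
  have [a0|] := eqVneq a 0; last by exists a.
  exists b; split=> //; apply: contraNneq x_neq0 => b0.
  by rewrite xE a0 b0 scaler0 addr0.
have w_gt0 : 0 < '[w] by rewrite lt_def dot_eq0 w_neq0 dot_ge0.
have s_gt0 : 0 < sqrtC '[w] by rewrite sqrtC_gt0.
exists ((sqrtC '[w])^-1 *: w); split.
- by rewrite mxOverZ // realV gtr0_real.
- rewrite dotZ normfV (ger0_norm (ltW s_gt0)) exprVn sqrtCK mulVf //.
  by rewrite gt_eqF.
- by rewrite -scalemxAl wG scaler0.
Qed.

(* A Householder reflection exchanging v and the first basis vector. *)
Lemma householder n (v : 'rV[C]_(1 + n)) : v \is a realmx -> '[v] = 1 ->
  exists H : 'M[C]_(1 + n),
    [/\ H \is a realmx, H *m H^T = 1%:M & row_mx 1%:M 0 *m H = v].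
Proof.
set e := row_mx _ _ => Rv v1.
have Re : e \is a realmx by rewrite realmx_row ?realmx1 ?realmx0.
have vv : v *m v^T = 1%:M by rewrite [LHS]mx11_scalar -dot_realE // v1.
have ee : e *m e^T = 1%:M.
  by rewrite tr_row_mx mul_row_col trmx1 mul1mx trmx0 mulmx0 addr0.
pose u := v - e; have Ru : u \is a realmx by rewrite realmxB.
(* If [v] is already the first basis vector there is no mirror, and the identity serves. *)
have [u0|u_neq0] := eqVneq u 0.
  exists 1%:M; split; rewrite ?realmx1 ?trmx1 ?mulmx1 //.
  by apply/esym/eqP; rewrite -subr_eq0 -/u u0.
pose t := (e *m v^T) 0 0; pose s := 2 - 2 * t.
have ev : e *m v^T = t%:M by rewrite [LHS]mx11_scalar.
have ve : v *m e^T = t%:M by rewrite -[LHS]trmxK trmx_mul trmxK ev tr_scalar_mx.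
have uu : u *m u^T = s%:M.
  rewrite raddfB /= mulmxBr !mulmxBl vv ee ev ve -!raddfB /=.
  by congr _%:M; rewrite /s; ring.
have s_neq0 : s != 0.
  by apply: contraNneq u_neq0 => s0; rewrite -dot_eq0 dot_realE // uu s0 mxE mul0rn.
have Rs : s \is Num.real.
  have : u *m u^T \is a realmx by rewrite realmxM ?realmx_tr.
  by move/mxOverP/(_ 0 0); rewrite uu mxE.
(* Reflection in the hyperplane orthogonal to [u], whose squared norm is [s]. *)
pose H := 1%:M - (2 / s) *: (u^T *m u).
have symH : H^T = H by rewrite raddfB /= trmx1 linearZ /= trmx_mul trmxK.
exists H; split.
- rewrite realmxB ?realmx1 // mxOverZ ?realmxM ?realmx_tr //.
  by rewrite rpredM ?realV ?realn.
- rewrite symH mulmxBl mul1mx mulmxBr mulmx1 -scalemxAl -scalemxAr.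
  rewrite -[u^T *m u *m _]mulmxA (mulmxA u) uu mul_scalar_mx -scalemxAr !scalerA.
  have -> : 2 / s * (2 / s * s) = 2 / s + 2 / s by field.
  by rewrite scalerDl opprB addrK /H subrK.
- rewrite mulmxBr mulmx1 -scalemxAr mulmxA.
  have -> : e *m u^T = (t - 1)%:M by rewrite raddfB /= mulmxBr ev ee raddfB.
  rewrite mul_scalar_mx scalerA.
  have -> : 2 / s * (t - 1) = - 1 by rewrite /s in s_neq0 *; field.
  by rewrite scaleN1r opprK /u addrC subrK.
Qed.

(** [v] is a real unit eigenvector of [M *m M^T], [s] the square root of its eigenvalue [l], and [u]
    is [v *m M] normalized. *)
Lemma real_singular_pair n (M : 'M[C]_(1 + n)) : M \is a realmx ->
  exists (u v : 'rV[C]_(1 + n)) (s : C),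
    [/\ [/\ u \is a realmx, v \is a realmx, '[u] = 1 & '[v] = 1], 0 <= s,
        v *m M = s *: u & u *m M^T = s *: v].
Proof.
move=> RM; pose G := M *m M^T.
have RG : G \is a realmx by rewrite realmxM ?realmx_tr.
have [//|l /eigenvalueP[x xG x_neq0]] := eigenvalue_closed G.
have x_gt0 : 0 < '[x] by rewrite lt_def dot_eq0 x_neq0 dot_ge0.
have l_ge0 : 0 <= l.
  have : 0 <= l * '[x].
    have <- : '[x *m M] = l * '[x] ; last exact: dot_ge0.
    rewrite dotmxE trmx_mul map_mxM (realmxC (realmx_tr RM)) mulmxA -(mulmxA x) xG.
    by rewrite -scalemxAl mxE -dotmxE.
  by rewrite pmulr_lge0.
have [||v [Rv v1 vG0]] := @real_kernel _ (G - l%:M) x _ x_neq0.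
- by rewrite realmxB // realmx_scalar // ger0_real.
- by rewrite mulmxBr xG mul_mx_scalar subrr.
have vG : v *m M *m M^T = l *: v.
  by rewrite -mulmxA; apply/eqP; rewrite -subr_eq0 -mul_mx_scalar -mulmxBr vG0.
have dvM : '[v *m M] = l.
  rewrite dot_realE ?realmxM // trmx_mul mulmxA vG -scalemxAl mxE -dot_realE //.
  by rewrite v1 mulr1.
(* For [l = 0] the row [v *m M] vanishes and cannot be normalized; [M] is then singular, and a real
   unit row killed by [M^T] serves as [u]. *)
have [l0|l_neq0] := eqVneq l 0.
  have vM : v *m M = 0 by apply/eqP; rewrite -dot_eq0 dvM l0.
  have : ~~ (M^T \in unitmx).
    rewrite unitmx_tr; apply/negP => uM.
    have := vM => /(canRL (mulmxK uM)); rewrite mul0mx => v0.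
    by move: v1; rewrite v0 dotmxE mul0mx mxE => /esym/eqP; rewrite oner_eq0.
  rewrite -row_free_unit -kermx_eq0 => /rowV0Pn[w /sub_kermxP wM w_neq0].
  have [u [Ru u1 uM]] := real_kernel (realmx_tr RM) w_neq0 wM.
  by exists u, v, 0; split; rewrite ?scale0r.
have l_gt0 : 0 < l by rewrite lt_def l_neq0.
pose s := sqrtC l; have s_gt0 : 0 < s by rewrite sqrtC_gt0.
exists (s^-1 *: (v *m M)), v, s; split; rewrite ?ltW //.
- split=> //; first by rewrite mxOverZ ?realmxM // realV gtr0_real.
  by rewrite dotZ normfV (ger0_norm (ltW s_gt0)) exprVn sqrtCK dvM mulVf.
- by rewrite scalerA divff ?scale1r // gt_eqF.
- rewrite -scalemxAl vG scalerA; congr (_ *: _).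
  by rewrite -[l]sqrtCK -/s; field; rewrite gt_eqF.
Qed.

(** Deflation, which also covers singular [M]: two reflections carry a singular pair to the first
    basis vector, leaving the singular value [s] beside a smaller block. *)
Lemma real_polar n (M : 'M[C]_n) : M \is a realmx ->
  exists U B : 'M[C]_n, [/\ U \is a realmx /\ B \is a realmx,
    U^T *m U = 1%:M, B^T = B, psd B & M = U *m B].
Proof.
elim: n M => [|n IHn] M RM.
  exists 1%:M, 1%:M; rewrite !realmx1; split=> //; rewrite ?trmx1 ?mulmx1 //.
    by move=> x _; rewrite mxE big_ord0.
  by rewrite [LHS]flatmx0 [RHS]flatmx0.
move: M RM; rewrite -[n.+1]/(1 + n)%N => M RM.
have [u [v [s [[Ru Rv u1 v1] s_ge0 vM uM]]]] := real_singular_pair RM.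
have [H [RH HH eH]] := householder Ru u1.
have [K [RK KK eK]] := householder Rv v1.
have HH' := mulmx1C HH; have KK' := mulmx1C KK.
pose N := K *m M *m H^T; have RN : N \is a realmx by rewrite !realmxM ?realmx_tr.
set e := row_mx _ _ in eH eK.
have eN : e *m N = s *: e.
  by rewrite !mulmxA eK vM -scalemxAl -eH -mulmxA HH mulmx1.
have eNT : e *m N^T = s *: e.
  by rewrite !trmx_mul trmxK !mulmxA eH uM -scalemxAl -eK -mulmxA KK mulmx1.
(* The first basis row is an eigenvector of both [N] and [N^T], so the first row and column of [N]
   vanish off the diagonal. *)
have defN : N = block_mx s%:M 0 0 (drsubmx N).
  have := eN; rewrite -[in LHS](submxK N) mul_row_block !mul0mx !mul1mx !addr0.
  rewrite scale_row_mx scaler0 scalemx1 => /eq_row_mx[eul eur].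
  have := eNT; rewrite -[in LHS](submxK N) tr_block_mx mul_row_block.
  rewrite !mul0mx !mul1mx !addr0 scale_row_mx scaler0 scalemx1.
  move=> /eq_row_mx[_ /(congr1 trmx)]; rewrite trmxK trmx0 => edl.
  by rewrite -[LHS]submxK eul eur edl.
have RN' : drsubmx N \is a realmx by apply/mxOverP => i j; rewrite 2!mxE; apply: (mxOverP RN).
have [U [B [[RU RB] UU BB pB eUB]]] := IHn _ RN'.
(* From [M = K^T *m N *m H], with [H *m H^T = 1%:M] inserted between the polar factors of [N]. *)
exists (K^T *m block_mx 1%:M 0 0 U *m H), (H^T *m block_mx s%:M 0 0 B *m H).
split.
- by rewrite !realmxM ?realmx_tr ?realmx_block ?realmx0 ?realmx1 ?realmx_scalar ?ger0_real.
- rewrite !trmx_mul trmxK !mulmxA -(mulmxA _ K) KK mulmx1 -(mulmxA H^T).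
  rewrite tr_block_mx mulmx_block !trmx0 !mulmx0 !mul0mx !addr0 !add0r UU trmx1 mulmx1.
  by rewrite -scalar_mx_block mulmx1.
- by rewrite !trmx_mul trmxK tr_block_mx !trmx0 tr_scalar_mx BB mulmxA.
- move=> x Rx; pose y := H *m x; have Ry : y \is a realmx by rewrite realmxM.
  have -> : x^T *m (H^T *m block_mx s%:M 0 0 B *m H) *m x
            = y^T *m block_mx s%:M 0 0 B *m y by rewrite /y trmx_mul !mulmxA.
  rewrite -[y]vsubmxK tr_col_mx mul_row_block !mulmx0 add0r addr0 mul_row_col mxE.
  rewrite addr_ge0 //; last first.
    by apply: pB; apply/mxOverP => i j; rewrite mxE; apply: (mxOverP Ry).
  rewrite mul_mx_scalar -scalemxAl mxE mulr_ge0 //.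
  rewrite -[X in (_ *m X) _ _]trmxK -dot_realE ?dot_ge0 //.
  by apply/mxOverP => i j; rewrite 2!mxE; apply: (mxOverP Ry).
rewrite !mulmxA -[K^T *m _ *m _ *m _]mulmxA HH mulmx1 -(mulmxA K^T).
rewrite mulmx_block !mulmx0 !mul0mx !addr0 !add0r -eUB mul1mx -defN.
by rewrite !mulmxA KK' mul1mx -mulmxA HH' mulmx1.
Qed.

End RealFactorizations.

(** * The real Weierstrass form and the spectrum of the pencil *)

Section Pencils.
Variable C : numClosedFieldType.

(* The coordinate-free form of index at most one, in terms of row vectors. *)
Lemma weierstrass_left_kernel q m n (e : (q + m)%N = n) (E A W T : 'M[C]_n)
    (J : 'M_q) : W \in unitmx -> T \in unitmx ->
  E = W *m castmx (e, e) (block_mx 1%:M 0 0 0) *m T ->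
  A = W *m castmx (e, e) (block_mx J 0 0 1%:M) *m T ->
  forall v w : 'rV_n, v *m E = 0 -> v *m A = w *m E -> v = 0.
Proof.
case: n / e E A W T => E A W T; rewrite !castmx_id => uW uT -> -> v w.
have fT : row_free T by rewrite row_free_unit.
rewrite !mulmxA -{1}(mul0mx _ T) => /(row_free_inj fT).
rewrite -[v *m W]hsubmxK !mul_row_block !mulmx0 mulmx1 !addr0.
rewrite -row_mx0 => /eq_row_mx[a0 _] /(row_free_inj fT).
rewrite -[w *m W]hsubmxK !mul_row_block !mulmx0 !mulmx1 !addr0 add0r.
move=> /eq_row_mx[_ b0]; rewrite -[v](mulmxK uW) -[v *m W]hsubmxK a0 b0.
by rewrite row_mx0 mul0mx.
Qed.

(** A given Weierstrass form may be complex, so a real one is rebuilt from the left kernel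
    condition. The size is an equation [e] between variables so that the cast can be eliminated;
    [blkdiag h] is the case [subnKC h]. *)
Lemma real_weierstrass r m n (e : (r + m)%N = n) (E A : 'M[C]_n) :
  \rank E = r -> E \is a realmx -> A \is a realmx ->
  (forall v w : 'rV_n, v *m E = 0 -> v *m A = w *m E -> v = 0) ->
  exists (W T : 'M[C]_n) (J : 'M[C]_r),
    [/\ [/\ W \is a realmx, T \is a realmx & J \is a realmx],
        W \in unitmx, T \in unitmx,
        E = W *m castmx (e, e) (block_mx 1%:M 0 0 0) *m T &
        A = W *m castmx (e, e) (block_mx J 0 0 1%:M) *m T].
Proof.
case: n / e E A => E A rE RE RA kerEA; rewrite !castmx_id.
(* Gaussian elimination commutes with conjugation, so it stays real. *)
have RW : col_ebase E \is a realmx.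
  apply/mxOverP => i j; apply/CrealP.
  by have /matrixP/(_ i j) := map_col_ebase (@Num.conj C) E; rewrite (realmxC RE) mxE.
have RT : row_ebase E \is a realmx.
  apply/mxOverP => i j; apply/CrealP.
  by have /matrixP/(_ i j) := map_row_ebase (@Num.conj C) E; rewrite (realmxC RE) mxE.
have := mulmx_ebase E; rewrite rE pid_mx_block.
move: (col_ebase E) (row_ebase E) (col_ebase_unit E) (row_ebase_unit E) RW RT.
move=> W T uW uT RW RT eE.
pose A0 := invmx W *m A *m invmx T.
have RA0 : A0 \is a realmx by rewrite !realmxM ?realmx_inv.
have eA : A = W *m A0 *m T by rewrite !mulmxA mulmxV // mul1mx mulmxKV.
pose A1 := ulsubmx A0; pose A2 := ursubmx A0; pose A3 := dlsubmx A0.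
pose A4 := drsubmx A0.
have RA1 : A1 \is a realmx by apply/mxOverP => i j; rewrite 2!mxE; apply: (mxOverP RA0).
have RA2 : A2 \is a realmx by apply/mxOverP => i j; rewrite 2!mxE; apply: (mxOverP RA0).
have RA3 : A3 \is a realmx by apply/mxOverP => i j; rewrite 2!mxE; apply: (mxOverP RA0).
have RA4 : A4 \is a realmx by apply/mxOverP => i j; rewrite 2!mxE; apply: (mxOverP RA0).
have defA0 : A0 = block_mx A1 A2 A3 A4 by rewrite submxK.
(* If [b *m A4 = 0], then [v = row_mx 0 b *m invmx W] satisfies [v *m E = 0], while [v *m A] is a
   row of the form [w *m E]; hence [b = 0]. *)
have uA4 : A4 \in unitmx.
  rewrite -row_free_unit -kermx_eq0; apply/rowV0P => b /sub_kermxP bA4.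
  have := kerEA (row_mx 0 b *m invmx W) (row_mx (b *m A3) 0 *m invmx W).
  rewrite -eE eA defA0 !mulmxA !mulmxKV // !mul_row_block bA4.
  rewrite !mulmx0 !mul0mx !mulmx1 !add0r addr0 row_mx0 mul0mx => /(_ erefl erefl).
  by move=> /(canRL (mulmxKV uW)); rewrite mul0mx -row_mx0 => /eq_row_mx[].
(* The Schur complement of [A4]: block elimination turns [A0] into the blocks [J] and [1%:M], and
   its two triangular factors leave the form of [E] unchanged. *)
pose J := A1 - A2 *m invmx A4 *m A3.
exists (W *m block_mx 1%:M A2 0 A4), (block_mx 1%:M 0 (invmx A4 *m A3) 1%:M *m T), J.
split.
- have Ri := realmx_inv RA4.
  have R43 : invmx A4 *m A3 \is a realmx by rewrite realmxM.
  split; last by rewrite /J -mulmxA realmxB // realmxM.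
    by rewrite realmxM // realmx_block ?realmx1 ?realmx0.
  by rewrite realmxM // realmx_block ?realmx1 ?realmx0.
- by rewrite unitmx_mul uW unitmxE det_ublock det1 mul1r.
- by rewrite unitmx_mul uT andbT unitmxE det_lblock !det1 mulr1 unitr1.
- rewrite -[LHS]eE !mulmxA; congr (_ *m _); rewrite -!mulmxA; congr (_ *m _).
  by rewrite !mulmx_block !(mulmx0, mul0mx, mulmx1, mul1mx, addr0).
rewrite eA defA0 !mulmxA; congr (_ *m _); rewrite -!mulmxA; congr (_ *m _).
rewrite !mulmx_block !(mulmx0, mul0mx, mulmx1, mul1mx, addr0, add0r).
by rewrite !mulmxA mulmxV // mul1mx subrK.
Qed.

(** The pencil is [W] times the blocks [char_poly_mx J] and [- 1%:M] times [T]; the constant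
    collects the determinants of [W], [T] and [- 1%:M]. *)
Lemma pencil_det_weierstrass q m n (e : (q + m)%N = n) (E A W T : 'M[C]_n)
    (J : 'M_q) : W \in unitmx -> T \in unitmx ->
  E = W *m castmx (e, e) (block_mx 1%:M 0 0 0) *m T ->
  A = W *m castmx (e, e) (block_mx J 0 0 1%:M) *m T ->
  exists2 c : C, c != 0 & pencil_det E A = c *: char_poly J.
Proof.
case: n / e E A W T => E A W T; rewrite !castmx_id => uW uT defE defA.
have -> : pencil_det E A =
    \det ('X *: map_mx polyC E - map_mx polyC A).
  by congr (\det _); apply/matrixP => i j; rewrite !mxE.
exists (\det W * (-1) ^+ m * \det T).
  by rewrite !mulf_neq0 ?signr_eq0 // -unitfE -unitmxE.
rewrite defE defA !map_mxM scalemxAl scalemxAr -mulmxBl -mulmxBr !det_mulmx.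
have -> : 'X *: map_mx polyC (block_mx (1%:M : 'M[C]_q) 0 0 (0 : 'M_m))
    - map_mx polyC (block_mx J 0 0 1%:M) = block_mx (char_poly_mx J) 0 0 (- 1%:M).
  rewrite !map_block_mx !map_mx0 !map_mx1 scale_block_mx !scaler0 scalemx1.
  by rewrite opp_block_mx add_block_mx !oppr0 !addr0 add0r.
rewrite det_ublock -scaleN1r detZ det1 mulr1 !det_map_mx -/(char_poly J).
have -> : (-1) ^+ m = ((-1) ^+ m)%:P :> {poly C} by rewrite rmorphXn rmorphN1.
by rewrite -mul_polyC !rmorphM /=; ring.
Qed.

Lemma geo_mult_weierstrass q m n (e : (q + m)%N = n) (E A W T : 'M[C]_n)
    (J : 'M_q) z : W \in unitmx -> T \in unitmx ->
  E = W *m castmx (e, e) (block_mx 1%:M 0 0 0) *m T ->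
  A = W *m castmx (e, e) (block_mx J 0 0 1%:M) *m T ->
  geo_mult E A z = (q - \rank (J - z%:M)%R)%N.
Proof.
case: n / e E A W T => E A W T; rewrite !castmx_id => uW uT -> ->.
rewrite /geo_mult scalemxAl scalemxAr -mulmxBl -mulmxBr.
rewrite mxrankMfree ?row_free_unit // (eqmxMfull _ _) ?row_full_unit //.
rewrite scale_block_mx !scaler0 scalemx1 opp_block_mx add_block_mx !oppr0 !addr0 add0r.
rewrite rank_diag_block_mx -opprB !mxrank_opp mxrank1.
by rewrite subnDr.
Qed.

(** The pencil determinant is a nonzero constant times the monic [char_poly J], so eigenvalues and
    both multiplicities are those of [J]. *)
Lemma stable_weierstrass q m n (e : (q + m)%N = n) (E A W T : 'M[C]_n)
    (J : 'M_q) : W \in unitmx -> T \in unitmx ->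
  E = W *m castmx (e, e) (block_mx 1%:M 0 0 0) *m T ->
  A = W *m castmx (e, e) (block_mx J 0 0 1%:M) *m T ->
  regular_pair E A /\ (stable_pair E A <-> disk_semisimple J).
Proof.
move=> uW uT defE defA.
have [c c_neq0 detEA] := pencil_det_weierstrass uW uT defE defA.
have cJ_neq0 : char_poly J != 0 by rewrite monic_neq0 ?char_poly_monic.
split; first by rewrite /regular_pair detEA scaler_eq0 (negbTE c_neq0).
have ss z : semisimple_eig E A z <-> semisimple J z.
  rewrite /semisimple_eig /alg_mult (geo_mult_weierstrass _ uW uT defE defA).
  rewrite detEA -mul_polyC mupMr ?rootC //; exact: semisimple_mup.
have eig z : finite_eig E A z = root (char_poly J) z.
  by rewrite /finite_eig detEA rootZ.
by split=> st z; have := st z; rewrite eig => stz /stz[z_le1 ssz];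
  split=> // /ssz/ss.
Qed.

End Pencils.

(** * Admissible pairs and the factored form of the finite block *)

Theorem theorem3 (C : numClosedFieldType) (n : nat) (E A : 'M[C]_n)
    (HE : E \is a realmx) (HA : A \is a realmx) :
  admissible E A <->
  exists (W T : 'M[C]_n) (S U B : 'M[C]_(\rank E)),
    [/\ [/\ W \is a realmx, T \is a realmx, W \in unitmx & T \in unitmx],
        [/\ S \is a realmx, U \is a realmx, B \is a realmx & S \in unitmx],
        [/\ U^T *m U = 1%:M, B^T = B, psd B & spec_norm_le1 B],
        E = W *m blkdiag (rank_leq_row E) 1%:M 0 *m T &
        A = W *m blkdiag (rank_leq_row E) (invmx S *m U *m B *m S) 1%:M *m T].
Proof.
split=> [[_ [q [h [W0 [T0 [J0 [uW0 uT0 defE0 defA0]]]]]] stEA] |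
         [W [T [S [U [B [[RW RT uW uT] [RS RU RB uS] [UU symB psdB B_le1] defE defA]]]]]]].
- have kerEA := weierstrass_left_kernel uW0 uT0 defE0 defA0.
  have [W [T [J [[RW RT RJ] uW uT defE defA]]]] :=
    real_weierstrass (subnKC (rank_leq_row E)) erefl HE HA kerEA.
  have dJ := (stable_weierstrass uW uT defE defA).2.1 stEA.
  have [S [RS uS cM]] := disk_real_contraction RJ dJ.
  have RM : S *m J *m invmx S \is a realmx by rewrite !realmxM ?realmx_inv.
  have [U [B [[RU RB] UU symB psdB defM]]] := real_polar RM.
  have defJ : invmx S *m U *m B *m S = J.
    by rewrite -(mulmxA _ U) -defM !mulmxA mulVmx // mul1mx mulmxKV.
  exists W, T, S, U, B; rewrite defJ; split=> //; split=> // x Rx.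
  (* The contraction [U *m B] is tested on [x^T *m U^T]: this row has the norm of [x], and its image
     is [x^T *m B], the transpose of [B *m x]. *)
  have Ry : x^T *m U^T \is a realmx by rewrite realmxM ?realmx_tr.
  have := cM (x^T *m U^T).
  rewrite defM mulmxA -(mulmxA x^T) UU mulmx1 !dot_realE ?realmxM ?realmx_tr //.
  by rewrite !trmx_mul !trmxK symB !mulmxA -(mulmxA x^T) UU mulmx1.
- have [regEA stEA] := stable_weierstrass uW uT defE defA.
  split=> //; first by exists (\rank E), (rank_leq_row E), W, T, (invmx S *m U *m B *m S).
  apply/stEA; have UU' := mulmx1C UU.
  (* The finite block is similar to [U *m B], which is a contraction because [U] is orthogonal and
     [B] has norm at most one. *)
  apply: (@disk_semisimple_similar _ _ (invmx S) (U *m B)).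
  - by rewrite unitmx_inv.
  - by rewrite !mulmxA mulmxK.
  apply/contraction_disk/contraction_real; first by rewrite realmxM.
  move=> x Rx; have Ry : (x *m U)^T \is a realmx by rewrite realmx_tr ?realmxM.
  have := B_le1 _ Ry; rewrite !dot_realE ?realmxM //.
  by rewrite !trmx_mul !trmxK symB !mulmxA -(mulmxA x U U^T) UU' mulmx1.
Qed.
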